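(* Let $\{A,B,C\}\subset S^{1,1}$ be a tempolateral de Sitter triangle such that the first components of the tangent vectors $X_{AB}$ and $X_{AC}$ have different signs. Let $a,b,c$ be the side lengths opposite $A,B,C$ and $\alpha,\beta,\gamma$ the angles at $A,B,C$. Then $$\cosh(a)=\cosh(b)\cosh(c)+\cosh(\alpha)\sinh(b)\sinh(c),$$ $$\cosh(b)=\cosh(a)\cosh(c)-\cosh(\beta)\sinh(a)\sinh(c),$$ $$\cosh(c)=\cosh(a)\cosh(b)-\cosh(\gamma)\sinh(a)\sinh(b).$$
   Context: On $\mathbb{R}^3$ let $\langle\langle x,y\rangle\rangle=-x_1y_1+x_2y_2+x_3y_3$, $|||x|||=\sqrt{|\langle\langle x,x\rangle\rangle|}$, and let $\times$ be the Euclidean cross product. $S^{1,1}=\{x:\langle\langle x,x\rangle\rangle=1\}$. For distinct $A,B\in S^{1,1}$, the side between $A$ and $B$ is timelike if $A-B$ is timelike, i.e. $\langle\langle A-B,A-B\rangle\rangle<0$ (equivalently $\langle\langle A,B\rangle\rangle>1$; $A$ and $B$ lie on the same branch of a great hyperbola). Its length is then $\operatorname{arcosh}(\langle\langle A,B\rangle\rangle)$, and the unit tangent vector at $A$ towards $B$ is $X_{AB}=\dfrac{B-\langle\langle A,B\rangle\rangle A}{|||A\times B|||}$. A tempolateral triangle is a set of three distinct points $\{A,B,C\}\subset S^{1,1}$ all of whose sides are timelike. Side lengths: $a$ between $B$ and $C$, $b$ between $A$ and $C$, $c$ between $A$ and $B$. The angle at $A$ is $\alpha=\operatorname{arcosh}(|\langle\langle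 X_{AB},X_{AC}\rangle\rangle|)\ge0$, and analogously $\beta$ at $B$, $\gamma$ at $C$. ''First component'' means the $x_1$-coordinate. *)

(* Defs.v *)
From Stdlib Require Import Reals.
From Coquelicot Require Import Coquelicot.
Open Scope R_scope.

(* Addition, difference and scaling of vectors are Coquelicot's [plus],
   [minus] and [scal] for the product module structure on [R * R * R]. *)
Definition R3 : Type := (R * R * R)%type.

Definition x1 (v : R3) : R := fst (fst v).
Definition x2 (v : R3) : R := snd (fst v).
Definition x3 (v : R3) : R := snd v.

Definition lorentz (v w : R3) : R :=
  - (x1 v * x1 w) + x2 v * x2 w + x3 v * x3 w.

Definition lnorm (v : R3) : R := sqrt (Rabs (lorentz v v)).

(* The Euclidean cross product, not the Lorentzian one. *)
Definition cross (v w : R3) : R3 :=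
  (x2 v * x3 w - x3 v * x2 w,
   x3 v * x1 w - x1 v * x3 w,
   x1 v * x2 w - x2 v * x1 w).

Definition timelike (v : R3) : Prop := lorentz v v < 0.

(* The de Sitter surface S^{1,1}. *)
Definition de_sitter (v : R3) : Prop := lorentz v v = 1.

(* Inverse of [cosh] restricted to [0, +oo); meaningful for [1 <= x] only.
   Same closed form as Stdlib's [arcsinh]. *)
Definition arcosh (x : R) : R := ln (x + sqrt (x ^ 2 - 1)).

Definition timelike_side (A B : R3) : Prop := timelike (minus A B).

(* Length of the side between [A] and [B], when that side is timelike. *)
Definition side_length (A B : R3) : R := arcosh (lorentz A B).

(* The unit tangent vector X_{AB} at [A] towards [B]. *)
Definition tangent (A B : R3) : R3 :=
  scal (/ lnorm (cross A B)) (minus B (scal (lorentz A B) A)).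

(* The angle at the first argument [A]. *)
Definition angle (A B C : R3) : R :=
  arcosh (Rabs (lorentz (tangent A B) (tangent A C))).

Definition tempolateral (A B C : R3) : Prop :=
  (de_sitter A /\ de_sitter B /\ de_sitter C) /\
  (A <> B /\ B <> C /\ A <> C) /\
  (timelike_side A B /\ timelike_side B C /\ timelike_side A C).

Definition different_signs (x y : R) : Prop := (x < 0 < y) \/ (y < 0 < x).

(* Main.v *)
(** The Gram determinant of [A], [B], [C] is minus the square of [det(A,B,C)]; hence
    [(r - p q)^2 >= (p^2 - 1) (q^2 - 1)] for [p = <<A,B>>], [q = <<A,C>>],
    [r = <<B,C>>] in any order, and the angle at each vertex satisfies
    [cosh alpha * sinh b * sinh c = |r - p q|].  What remains is the sign of each
    [r - p q].  At [A] it is positive, because timelike vectors whose first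
    components have opposite signs have positive product.  So [r > p q], and this
    forces [q < p r] and [p < q r], the signs at [B] and [C]. *)

Require Import Defs.
From Stdlib Require Import Reals Lra.
From Coquelicot Require Import Coquelicot.
Open Scope R_scope.

Lemma cosh_arcosh (x : R) : 1 <= x -> cosh (arcosh x) = x.
Proof.
  intros Hx; unfold cosh, arcosh.
  pose proof (sqrt_pos (x ^ 2 - 1)) as Hs.
  assert (Hq : sqrt (x ^ 2 - 1) * sqrt (x ^ 2 - 1) = x ^ 2 - 1)
    by (apply sqrt_sqrt; nra).
  rewrite exp_Ropp, exp_ln by lra.
  (* The two conjugates multiply to [x ^ 2 - (x ^ 2 - 1) = 1]. *)
  replace (/ (x + sqrt (x ^ 2 - 1))) with (x - sqrt (x ^ 2 - 1)); [lra|].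
  apply (Rmult_eq_reg_r (x + sqrt (x ^ 2 - 1))); [|lra].
  rewrite Rinv_l by lra; nra.
Qed.

Lemma sinh_arcosh (x : R) : 1 <= x -> sinh (arcosh x) = sqrt (x ^ 2 - 1).
Proof.
  intros Hx.
  assert (H : exp (arcosh x) = x + sqrt (x ^ 2 - 1)).
  { pose proof (sqrt_pos (x ^ 2 - 1)); unfold arcosh; rewrite exp_ln; lra. }
  assert (Hc := cosh_arcosh x Hx).
  unfold cosh in Hc; unfold sinh; lra.
Qed.

Ltac coordinates :=
  unfold lorentz, cross, x1, x2, x3, minus, plus, opp, scal; simpl;
  unfold minus, plus, opp, scal, mult; simpl; unfold mult; simpl.

Lemma lorentz_sym (v w : R3) : lorentz v w = lorentz w v.
Proof. unfold lorentz; ring. Qed.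

Lemma lorentz_scal (s t : R) (v w : R3) :
  lorentz (scal s v) (scal t w) = s * t * lorentz v w.
Proof. destruct v as [[v1 v2] v3], w as [[w1 w2] w3]; coordinates; ring. Qed.

Lemma lorentz_minus_scal (p q : R) (A B C : R3) :
  lorentz (minus B (scal p A)) (minus C (scal q A)) =
  lorentz B C - q * lorentz A B - p * lorentz A C + p * q * lorentz A A.
Proof.
  destruct A as [[A1 A2] A3], B as [[B1 B2] B3], C as [[C1 C2] C3].
  coordinates; ring.
Qed.

Lemma timelike_side_gt1 (A B : R3) :
  de_sitter A -> de_sitter B -> timelike_side A B -> 1 < lorentz A B.
Proof.
  unfold timelike_side, timelike, de_sitter; intros HA HB H.
  assert (E : lorentz (minus A B) (minus A B) =
              lorentz A A + lorentz B B - 2 * lorentz A B).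
  { destruct A as [[A1 A2] A3], B as [[B1 B2] B3]; coordinates; ring. }
  lra.
Qed.

(** Lorentzian Lagrange identity: the Euclidean cross product differs from the Lorentzian one only
    by the sign of a coordinate, which [lorentz] does not see on squares. The value is [sinh] of the
    side length, the form in which it enters the laws of cosines. *)
Lemma lnorm_cross (A B : R3) :
  de_sitter A -> de_sitter B -> 1 < lorentz A B ->
  lnorm (cross A B) = sqrt (lorentz A B ^ 2 - 1).
Proof.
  unfold de_sitter, lnorm; intros HA HB H; f_equal.
  assert (E : lorentz (cross A B) (cross A B) =
              lorentz A B ^ 2 - lorentz A A * lorentz B B).
  { destruct A as [[A1 A2] A3], B as [[B1 B2] B3]; coordinates; ring. }
  rewrite E, HA, HB, Rabs_pos_eq; nra.
Qed.

Lemma gram_inequality (A B C : R3) :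
  de_sitter A -> de_sitter B -> de_sitter C ->
  (lorentz A B ^ 2 - 1) * (lorentz A C ^ 2 - 1) <=
  (lorentz B C - lorentz A B * lorentz A C) ^ 2.
Proof.
  unfold de_sitter; intros HA HB HC.
  assert (E : lorentz A A * lorentz B B * lorentz C C
     + 2 * lorentz A B * lorentz A C * lorentz B C
     - lorentz A A * lorentz B C ^ 2 - lorentz B B * lorentz A C ^ 2
     - lorentz C C * lorentz A B ^ 2 =
     - (x1 A * x1 (cross B C) + x2 A * x2 (cross B C) + x3 A * x3 (cross B C)) ^ 2).
  { destruct A as [[A1 A2] A3], B as [[B1 B2] B3], C as [[C1 C2] C3].
    coordinates; ring. }
  rewrite HA, HB, HC in E.
  pose proof (pow2_ge_0
    (x1 A * x1 (cross B C) + x2 A * x2 (cross B C) + x3 A * x3 (cross B C))).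
  (* With unit diagonal, minus the Gram determinant is [(r - p q)^2 - (p^2 - 1) (q^2 - 1)]. *)
  nra.
Qed.

Lemma lorentz_tangent (A B C : R3) :
  de_sitter A -> de_sitter B -> de_sitter C ->
  1 < lorentz A B -> 1 < lorentz A C ->
  lorentz (tangent A B) (tangent A C) *
    sqrt (lorentz A C ^ 2 - 1) * sqrt (lorentz A B ^ 2 - 1) =
  lorentz B C - lorentz A B * lorentz A C.
Proof.
  intros HA HB HC Hp Hq; unfold tangent.
  rewrite lorentz_scal, lorentz_minus_scal, !lnorm_cross, HA by assumption.
  assert (0 < sqrt (lorentz A B ^ 2 - 1)) by (apply sqrt_lt_R0; nra).
  assert (0 < sqrt (lorentz A C ^ 2 - 1)) by (apply sqrt_lt_R0; nra).
  field; lra.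
Qed.

Lemma cosh_angle (A B C : R3) :
  de_sitter A -> de_sitter B -> de_sitter C ->
  1 < lorentz A B -> 1 < lorentz A C ->
  cosh (angle A B C) *
    sqrt (lorentz A C ^ 2 - 1) * sqrt (lorentz A B ^ 2 - 1) =
  Rabs (lorentz B C - lorentz A B * lorentz A C).
Proof.
  intros HA HB HC Hp Hq.
  pose proof (lorentz_tangent A B C HA HB HC Hp Hq) as E.
  pose proof (gram_inequality A B C HA HB HC) as G.
  assert (Hc : 0 < sqrt (lorentz A B ^ 2 - 1)) by (apply sqrt_lt_R0; nra).
  assert (Hb : 0 < sqrt (lorentz A C ^ 2 - 1)) by (apply sqrt_lt_R0; nra).
  assert (Qc : sqrt (lorentz A B ^ 2 - 1) ^ 2 = lorentz A B ^ 2 - 1)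
    by (apply pow2_sqrt; nra).
  assert (Qb : sqrt (lorentz A C ^ 2 - 1) ^ 2 = lorentz A C ^ 2 - 1)
    by (apply pow2_sqrt; nra).
  rewrite <- Qb, <- Qc, <- E in G; rewrite <- E.
  unfold angle; rewrite cosh_arcosh.
  - rewrite !Rabs_mult, (Rabs_pos_eq (sqrt _)), (Rabs_pos_eq (sqrt _)); lra.
  - revert G Hb Hc; generalize (lorentz (tangent A B) (tangent A C)).
    generalize (sqrt (lorentz A C ^ 2 - 1)) (sqrt (lorentz A B ^ 2 - 1)).
    intros s t k G Hs Ht.
    (* The argument of [arcosh] must be at least 1. Here [G] reads [t^2 s^2 <= (k s t)^2];
       cancelling [(s t)^2 > 0] leaves [1 <= k^2]. *)
    rewrite <- (Rabs_pos_eq 1) by lra; apply Rsqr_le_abs_0; unfold Rsqr.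
    assert (0 < s * t) by nra.
    apply (Rmult_le_reg_r ((s * t) ^ 2)); nra.
Qed.

(** Cauchy-Schwarz on the last two coordinates, whose norm is below that of the first for a timelike
    vector: the spatial product is smaller in absolute value than [- (x1 v * x1 w)], which is
    positive. *)
Lemma timelike_opposite_pos (v w : R3) :
  timelike v -> timelike w -> x1 v * x1 w < 0 -> 0 < lorentz v w.
Proof.
  unfold timelike, lorentz.
  generalize (x1 v) (x2 v) (x3 v) (x1 w) (x2 w) (x3 w).
  intros a b c d e f Hv Hw H.
  assert (CS : (b * e + c * f) ^ 2 <= (b * b + c * c) * (e * e + f * f))
    by (pose proof (pow2_ge_0 (b * f - c * e)); nra).
  assert ((b * b + c * c) * (e * e + f * f) < (a * d) ^ 2).
  (* The first comparison is only weak, since [b * b + c * c] may vanish; the second is strict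
     because [d] is nonzero. *)
  { apply Rle_lt_trans with ((b * b + c * c) * (d * d)).
    - apply Rmult_le_compat_l; nra.
    - assert (0 < d * d) by nra; nra. }
  nra.
Qed.

Lemma timelike_tangent (A B : R3) :
  de_sitter A -> de_sitter B -> 1 < lorentz A B -> timelike (tangent A B).
Proof.
  intros HA HB Hp; unfold timelike.
  (* Taking both endpoints equal gives [<<X,X>> (p^2 - 1) = 1 - p^2], so [<<X,X>> = -1]. *)
  pose proof (lorentz_tangent A B B HA HB HB Hp Hp) as E.
  rewrite HB in E.
  assert (Q : sqrt (lorentz A B ^ 2 - 1) * sqrt (lorentz A B ^ 2 - 1) =
              lorentz A B ^ 2 - 1) by (apply sqrt_sqrt; nra).
  rewrite Rmult_assoc, Q in E; nra.
Qed.

Theorem theorem5p4 (A B C : R3)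
  (hT : tempolateral A B C)
  (hsign : different_signs (x1 (tangent A B)) (x1 (tangent A C))) :
  let a := side_length B C in
  let b := side_length A C in
  let c := side_length A B in
  let alpha := angle A B C in
  let beta := angle B A C in
  let gamma := angle C A B in
  cosh a = cosh b * cosh c + cosh alpha * sinh b * sinh c /\
  cosh b = cosh a * cosh c - cosh beta * sinh a * sinh c /\
  cosh c = cosh a * cosh b - cosh gamma * sinh a * sinh b.
Proof.
  destruct hT as [[HA [HB HC]] [_ [TAB [TBC TAC]]]].
  apply timelike_side_gt1 in TAB, TBC, TAC; try assumption.
  assert (0 < lorentz (tangent A B) (tangent A C)) as Hpos.
  { apply timelike_opposite_pos; try (apply timelike_tangent; assumption).
    destruct hsign as [[]|[]]; nra. }
  assert (lorentz A B * lorentz A C < lorentz B C) as Hr.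
  { apply Rlt_0_minus.
    rewrite <- (lorentz_tangent A B C) by assumption.
    repeat apply Rmult_lt_0_compat; try assumption; apply sqrt_lt_R0; nra. }
  pose proof (cosh_angle A B C HA HB HC TAB TAC) as Ea.
  assert (TBA := TAB); rewrite lorentz_sym in TBA.
  assert (TCA := TAC); rewrite lorentz_sym in TCA.
  assert (TCB := TBC); rewrite lorentz_sym in TCB.
  pose proof (cosh_angle B A C HB HA HC TBA TBC) as Eb.
  pose proof (cosh_angle C A B HC HA HB TCA TCB) as Ec.
  rewrite (lorentz_sym B A) in Eb.
  rewrite (lorentz_sym C A), (lorentz_sym C B) in Ec.
  rewrite Rabs_pos_eq in Ea by lra.
  (* From [r > p q] and [p, q > 1]: [p r > p^2 q > q], and likewise [q r > q^2 p > p]. These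
     negative differences produce the minus signs in the last two laws. *)
  rewrite Rabs_left in Eb by nra.
  rewrite Rabs_left in Ec by nra.
  intros a b c alpha beta gamma; unfold a, b, c, alpha, beta, gamma, side_length.
  rewrite !cosh_arcosh, !sinh_arcosh by lra.
  repeat split; lra.
Qed.
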